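(* Let $f$ be a convex function from an interval $I\subseteq\mathbb{R}$ to $\mathbb{R}$. Let $x_1, x_2,\ldots,x_n$ be finitely many points from $I$, let $w_1, w_2, \ldots, w_n$ be nonnegative reals, and let $m$ be an integer. Assume that $w_1+w_2+\cdots+w_n\neq 0$, and that $w_{i_1}+w_{i_2}+\cdots+w_{i_m}\neq 0$ for any $m$ integers $i_1,i_2,\ldots,i_m$ satisfying $1\leq i_1<i_2<\cdots<i_m\leq n$. Then $$\binom{n-2}{m-1}\sum_{i=1}^n w_i f(x_i) + \binom{n-2}{m-2}\left(w_1+w_2+\cdots+w_n\right) f\left(\frac{w_1x_1+w_2x_2+\cdots+w_nx_n}{w_1+w_2+\cdots+w_n}\right)$$ $$\geq \sum_{1\leq i_1<i_2<\cdots<i_m\leq n}\left(w_{i_1}+w_{i_2}+\cdots+w_{i_m}\right) f\left(\frac{w_{i_1}x_{i_1}+w_{i_2}x_{i_2}+\cdots+w_{i_m}x_{i_m}}{w_{i_1}+w_{i_2}+\cdots+w_{i_m}}\right).$$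
   Context: Conventions: if $m\leq 0$ or $m>n$, the sum over $1\leq i_1<i_2<\cdots<i_m\leq n$ is regarded as empty and has value $0$ (and the corresponding nonvanishing assumption is vacuous). Binomial coefficients: $\binom{t}{k}=\frac{t(t-1)\cdots(t-k+1)}{k!}$ for integers $t$ and $k\geq 0$, and $\binom{t}{k}=0$ for $k<0$. *)

(* Defs.v *)
From HB Require Import structures.
From mathcomp Require Import all_boot all_order all_algebra.
From mathcomp Require Import all_classical all_reals all_analysis.
Import Order.TTheory GRing.Theory Num.Theory numFieldNormedType.Exports.

Set Implicit Arguments.
Unset Strict Implicit.
Unset Printing Implicit Defensive.

Local Open Scope ring_scope.

(* The upper argument may be negative: binomz R (-1) k = (-1) ^+ k for k >= 0,
   which is the value taken by 'C(n - 2, k) when n = 1. *)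
Definition binomz (R : numFieldType) (t k : int) : R :=
  match k with
  | Posz j => (\prod_(i < j) (t - i%:Z)%:~R) / (j`!)%:R
  | Negz _ => 0
  end.

(* A choice of 1 <= i_1 < ... < i_m <= n is encoded as the set {i_1, ..., i_m}.
   For m = 0 there is no admissible choice: the empty set is excluded. *)
Definition is_choice (n : nat) (m : int) (S : {set 'I_n}) : bool :=
  (0 < m) && (#|S|%:Z == m).

(* Main.v *)
(* Write [u] for the weighted mean of a set [T] of indices. Omitting the point
   [x i] from [T] moves the mean to the other side of [u]; the new mean is a
   convex combination of [u] and of the points of [T] lying on that other side,
   the point [x j] having a weight proportional to [w j * w i * |x i - u|].
   Summing
   Jensen's inequality over [i] in [T] gives the case m = |T| - 1. Summing that
   case over all [T] of cardinality m + 1 bounds the sum over m-subsets by the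
   sum over (m + 1)-subsets, and descending induction on m, starting from
   m = n, concludes. *)
Require Import Defs.
From HB Require Import structures.
From mathcomp Require Import all_boot all_order all_algebra.
From mathcomp Require Import all_classical all_reals all_analysis.
From mathcomp Require Import ring lra zify.
Import Order.TTheory GRing.Theory Num.Theory numFieldNormedType.Exports.

Set Implicit Arguments.
Unset Strict Implicit.
Unset Printing Implicit Defensive.

Local Open Scope ring_scope.

(** * Jensen's inequality with unnormalised weights *)

Lemma convex_function_weighted (R : realType) (I : set R) (f : R -> R)
    (a b u v : R) :
    is_interval I -> convex_function I f -> 0 < a -> 0 < b -> I u -> I v ->
  I ((a * u + b * v) / (a + b)) /\
  (a + b) * f ((a * u + b * v) / (a + b)) <= a * f u + b * f v.
Proof.
move=> hI hf a0 b0 Iu Iv.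
have ab0 : 0 < a + b by rewrite addr_gt0.
have abN0 : a + b != 0 by rewrite gt_eqF.
set t := a / (a + b).
have t0 : 0 <= t by rewrite divr_ge0 ?ltW.
have t1 : t <= 1 by rewrite ler_pdivrMr// mul1r lerDl ltW.
have eqt : (a * u + b * v) / (a + b) = t * u + (1 - t) * v.
  by rewrite /t; field.
split.
  have [uv|vu] := leP u v.
    apply: (hI _ _ Iu Iv); rewrite eqt; apply/andP; split; nra.
  apply: (hI _ _ Iv Iu); rewrite eqt; apply/andP; split; nra.
have : f (t * u + (1 - t) * v) <= t * f u + (1 - t) * f v.
  by have := hf (Itv01 t0 t1) u v; rewrite !inE => /(_ Iu Iv).
rewrite -eqt => /(ler_wpM2l (ltW ab0)) h.
apply: (le_trans h); rewrite le_eqVlt; apply/orP; left; apply/eqP.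
by rewrite /t; field.
Qed.

Lemma convex_function_jensen (R : realType) (I : set R) (f : R -> R)
    (X : finType) (A : {set X}) (a x : X -> R) :
    is_interval I -> convex_function I f ->
    (forall i, 0 <= a i) -> (forall i, I (x i)) -> 0 < \sum_(i in A) a i ->
  I ((\sum_(i in A) a i * x i) / \sum_(i in A) a i) /\
  (\sum_(i in A) a i) * f ((\sum_(i in A) a i * x i) / \sum_(i in A) a i)
    <= \sum_(i in A) a i * f (x i).
Proof.
move=> hI hf a0 Ix.
(* Weights may vanish, so the invariant has two cases: either all three sums are still 0, or the
   total weight is positive and the quotient is a genuine mean. *)
pose K (W V F : R) := [/\ W = 0, V = 0 & F = 0] \/
  [/\ 0 < W, I (V / W) & W * f (V / W) <= F].
suff : K (\sum_(i in A) a i) (\sum_(i in A) a i * x i)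
    (\sum_(i in A) a i * f (x i)).
  by move=> [[-> _ _]|[_ ? ?]]; rewrite ?ltxx.
apply: (big_rec3 K) => [|i W V F _]; first by left.
have := a0 i; rewrite le_eqVlt => /predU1P[<-|ai0].
  by rewrite !mul0r !add0r.
move=> [[-> -> ->]|[W0 IV hV]]; right.
  rewrite !addr0; have -> : a i * x i / a i = x i by field; rewrite gt_eqF.
  by split.
have [] := convex_function_weighted hI hf ai0 W0 (Ix i) IV.
have -> : W * (V / W) = V by field; rewrite gt_eqF.
move=> ? h; split => //; first exact: addr_gt0.
by apply: (le_trans h); rewrite lerD2l.
Qed.

(* The point [u - c * s / k] is the mean, with total weight [k], of the points
   [x j], [j \in N], with weights [c * w j], and of [u] with the remaining
   weight [k - c * \sum_(j in N) w j]. *)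
Lemma convex_function_opposite (R : realType) (I : set R) (f : R -> R)
    (X : finType) (N : {set X}) (w x : X -> R) (u s c k : R) :
    is_interval I -> convex_function I f ->
    (forall i, 0 <= w i) -> (forall i, I (x i)) -> I u ->
    0 <= c -> c <= 1 -> 0 < k -> \sum_(j in N) w j <= k ->
    \sum_(j in N) w j * (x j - u) = - s ->
  k * f (u - c * s / k)
    <= c * (\sum_(j in N) w j * f (x j)) + (k - c * \sum_(j in N) w j) * f u.
Proof.
move=> hI hf w0 Ix Iu c0 c1 k0 Nk es.
set wN := \sum_(j in N) w j in Nk es *.
have wN0 : 0 <= wN by apply: sumr_ge0.
have exs : \sum_(j in N) w j * x j = wN * u - s.
  rewrite -es /wN mulr_suml -big_split /=; apply: eq_bigr => i _; ring.
(* Degenerate case: [c = 0], or all weights on [N] vanish and then so does [s]; both sides are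
   [k * f u]. *)
have [cN|cN] := leP (c * wN) 0.
  have /eqP : c * wN = 0 by apply/eqP; rewrite eq_le cN mulr_ge0.
  rewrite mulf_eq0 => /orP[/eqP->|/eqP wN_0].
    by rewrite !mul0r !subr0 add0r.
  have wj j : j \in N -> w j = 0.
    by move=> jN; apply/eqP; move/eqP: wN_0;
      rewrite psumr_eq0// => /allP/(_ j (mem_index_enum _)); rewrite jN.
  have s0 : s = 0.
    by apply: oppr_inj; rewrite -es oppr0 big1// => j /wj ->; rewrite mul0r.
  rewrite s0 wN_0 big1; last by move=> j /wj ->; rewrite mul0r.
  by rewrite !mulr0 mul0r !subr0 add0r.
have cp : 0 < c.
  by rewrite lt_neqAle c0 andbT; apply: contraTneq cN => <-; rewrite mul0r ltxx.
have wNp : 0 < wN by rewrite -(pmulr_rgt0 _ cp).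
have [Iy hy] := convex_function_jensen hI hf w0 Ix wNp.
rewrite -/wN exs in Iy hy.
have cNk : c * wN <= k by rewrite (le_trans _ Nk)// ler_piMl.
have wNN0 : wN != 0 by rewrite gt_eqF.
have kN0 : k != 0 by rewrite gt_eqF.
set F := \sum_(j in N) _ in hy *.
(* If [c * wN = k], no weight is left at [u] and Jensen's inequality on [N] suffices; otherwise the
   mean of [N] is combined with [u]. *)
move: cNk; rewrite le_eqVlt => /predU1P[eqk|ltk].
  rewrite -eqk subrr mul0r addr0.
  have -> : u - c * s / (c * wN) = (wN * u - s) / wN.
    by field; rewrite wNN0 gt_eqF.
  by rewrite -mulrA ler_wpM2l.
have k'0 : 0 < k - c * wN by rewrite subr_gt0.
have [_] := convex_function_weighted hI hf cN k'0 Iy Iu.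
rewrite (addrC (c * wN)) subrK.
have -> : (c * wN * ((wN * u - s) / wN) + (k - c * wN) * u) / k
          = u - c * s / k by field; rewrite wNN0 kN0.
move=> h; apply: (le_trans h); rewrite lerD2r -mulrA ler_wpM2l//.
Qed.

(** The coefficients [w i * (x i - u) / s] are nonnegative and sum to 1 over [P], so summing the
    previous bound over [P] charges each [j] in [N] exactly [w j] in total. The sign of [s] is left
    open, so that the lemma also serves with [P] and [N] exchanged. *)
Lemma sum_convex_function_opposite (R : realType) (I : set R) (f : R -> R)
    (X : finType) (P N : {set X}) (w x : X -> R) (u s : R) (k : X -> R) :
    is_interval I -> convex_function I f ->
    (forall i, 0 <= w i) -> (forall i, I (x i)) -> I u -> s != 0 ->
    (forall i, i \in P -> 0 <= w i * (x i - u) / s) ->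
    \sum_(i in P) w i * (x i - u) = s ->
    \sum_(j in N) w j * (x j - u) = - s ->
    (forall i, i \in P -> 0 < k i /\ \sum_(j in N) w j <= k i) ->
  \sum_(i in P) k i * f (u - w i * (x i - u) / k i)
    <= (\sum_(j in N) w j * f (x j))
       + (\sum_(i in P) k i - \sum_(j in N) w j) * f u.
Proof.
move=> hI hf w0 Ix Iu s0 P0 eP eN hk.
pose c i := w i * (x i - u) / s.
have c0 i : i \in P -> 0 <= c i by exact: P0.
have ec i : w i * (x i - u) = c i * s by rewrite mulfVK.
have sc : \sum_(i in P) c i = 1 by rewrite -mulr_suml eP divff.
clearbody c.
have c1 i : i \in P -> c i <= 1.
  move=> iP; rewrite -sc (bigD1 i)//= lerDl sumr_ge0// => j /andP[jP _].
  exact: c0.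
apply: (@le_trans _ _ (\sum_(i in P) (c i * (\sum_(j in N) w j * f (x j))
    + (k i - c i * \sum_(j in N) w j) * f u))).
  apply: ler_sum => i iP; have [ki Nk] := hk i iP; rewrite ec.
  exact: (convex_function_opposite hI hf w0 Ix Iu (c0 i iP) (c1 i iP) ki Nk eN).
by rewrite big_split /= -!mulr_suml sumrB -mulr_suml sc !mul1r.
Qed.

(** * Omitting one index from a set *)

Definition wsum (R : realType) (X : finType) (w : X -> R) (S : {set X}) : R :=
  \sum_(i in S) w i.

Definition wmean (R : realType) (X : finType) (w x : X -> R) (S : {set X}) : R :=
  (\sum_(i in S) w i * x i) / wsum w S.

Definition wmeanf (R : realType) (X : finType) (f : R -> R) (w x : X -> R)
    (S : {set X}) : R :=
  wsum w S * f (wmean w x S).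

Lemma wsum_subset (R : realType) (X : finType) (w : X -> R) (A B : {set X}) :
  (forall i, 0 <= w i) -> A \subset B -> wsum w A <= wsum w B.
Proof.
move=> w0 /finset.setIidPr AB; rewrite /wsum [leRHS](big_setID A) /= AB lerDl.
exact: sumr_ge0.
Qed.

Lemma wsum_setD1 (R : realType) (X : finType) (w : X -> R) (T : {set X}) i :
  i \in T -> wsum w (T :\ i) = wsum w T - w i.
Proof. by move=> iT; rewrite /wsum [in RHS](big_setD1 i)//= addrAC subrr add0r. Qed.

(** The deviations [w i * (x i - u)] from the mean [u] sum to 0 over [T], hence to [s] over the
    indices with [u <= x i] and to [- s] over the others. Each side is bounded through the other and
    the two bounds are added. The weights [k i] of the sets [T :\ i] sum to [#|T| - 1] times the
    weight of [T], which leaves the factor [#|T| - 2] at [u]. *)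
Lemma sum_wmeanf_setD1_le (R : realType) (I : set R) (f : R -> R)
    (X : finType) (w x : X -> R) (T : {set X}) :
    is_interval I -> convex_function I f ->
    (forall i, 0 <= w i) -> (forall i, I (x i)) -> 0 < wsum w T ->
    (forall i, i \in T -> 0 < wsum w (T :\ i)) ->
  \sum_(i in T) wmeanf f w x (T :\ i)
    <= \sum_(i in T) w i * f (x i) + (#|T|%:R - 2) * wmeanf f w x T.
Proof.
move=> hI hf w0 Ix WT hk.
have [Iu hu] := convex_function_jensen hI hf w0 Ix WT.
rewrite -/(wsum w T) -/(wmean w x T) -/(wmeanf f w x T) in Iu hu.
set u := wmean w x T in Iu hu.
have WN0 : wsum w T != 0 by rewrite gt_eqF.
have eu : \sum_(i in T) w i * x i = wsum w T * u.
  by rewrite /u /wmean mulrC mulfVK.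
pose k i := wsum w T - w i.
have k0 i : i \in T -> 0 < k i by move=> iT; rewrite /k -wsum_setD1// hk.
have eg i : i \in T ->
    wmeanf f w x (T :\ i) = k i * f (u - w i * (x i - u) / k i).
  move=> iT; rewrite /wmeanf /wmean wsum_setD1// -/(k i).
  have -> : \sum_(j in T :\ i) w j * x j = wsum w T * u - w i * x i.
    by rewrite -eu; exact: (@wsum_setD1 _ _ (fun j => w j * x j)).
  congr (_ * f _).
  have -> : wsum w T = k i + w i by rewrite subrK.
  by field; rewrite gt_eqF ?k0.
rewrite (eq_bigr _ eg).
have sk : \sum_(i in T) k i = (#|T|%:R - 1) * wsum w T.
  by rewrite sumrB sumr_const -/(wsum w T) mulrBl mul1r mulr_natl.
pose d i := w i * (x i - u).
have sd : \sum_(i in T) d i = 0.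
  have -> : \sum_(i in T) d i = \sum_(i in T) w i * x i - wsum w T * u.
    by rewrite /wsum mulr_suml -sumrB; apply: eq_bigr => i _; rewrite /d mulrBr.
  by rewrite eu subrr.
pose A := [set i | u <= x i].
pose P := T :&: A; pose N := T :\: A.
have PT i : i \in P -> i \in T by case/finset.setIP.
have NT i : i \in N -> i \in T by case/finset.setDP.
have dP i : i \in P -> 0 <= d i.
  by case/finset.setIP => _; rewrite inE => ?; rewrite mulr_ge0// subr_ge0.
have dN i : i \in N -> 0 <= - d i.
  case/finset.setDP => _; rewrite inE -ltNge => xu.
  by rewrite -mulrN mulr_ge0// opprB subr_ge0 ltW.
have TPN F : \sum_(i in T) F i = \sum_(i in P) F i + \sum_(i in N) F i :> R.
  by rewrite (big_setID A).
set s := \sum_(i in P) d i.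
have sN : \sum_(i in N) d i = - s.
  by apply/eqP; rewrite -addr_eq0 addrC -TPN sd.
have s0 : 0 <= s by exact: sumr_ge0.
(* Since [i] lies outside [N], the set [N] is contained in [T :\ i]; this keeps the weight remaining
   at [u] nonnegative. *)
have PN i : i \in P -> 0 < k i /\ \sum_(j in N) w j <= k i.
  move=> iP; split; first exact/k0/PT.
  rewrite /k -wsum_setD1 ?PT//; apply: wsum_subset => //.
  apply/fintype.subsetP => j jN; rewrite !inE NT// andbT.
  apply: contraTneq jN => ->; move/finset.setIP: iP => [_].
  by rewrite !inE => ->.
have NP i : i \in N -> 0 < k i /\ \sum_(j in P) w j <= k i.
  move=> iN; split; first exact/k0/NT.
  rewrite /k -wsum_setD1 ?NT//; apply: wsum_subset => //.
  apply/fintype.subsetP => j jP; rewrite !inE PT// andbT.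
  apply: contraTneq jP => ->; move/finset.setDP: iN => [_].
  by rewrite !inE => /negbTE ->; rewrite andbF.
(* If [s = 0], all deviations vanish and every [T :\ i] has mean [u]: the claim reduces to Jensen's
   inequality on [T]. *)
have [s_0|sN0] := eqVneq s 0.
  have d0 i : i \in T -> d i = 0.
    move=> iT; have [iA|iA] := boolP (i \in A).
      have /eqP : s = 0 by [].
      rewrite psumr_eq0// => /allP/(_ i (mem_index_enum _)).
      by rewrite !inE in iA *; rewrite iT iA => /eqP.
    have /eqP : \sum_(i in N) - d i = 0 by rewrite sumrN sN s_0 !oppr0.
    rewrite psumr_eq0// => /allP/(_ i (mem_index_enum _)).
    by rewrite !inE in iA *; rewrite iT iA oppr_eq0 => /eqP.
  have -> : \sum_(i in T) k i * f (u - w i * (x i - u) / k i)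
      = (#|T|%:R - 1) * wsum w T * f u.
    rewrite -sk mulr_suml; apply: eq_bigr => i iT.
    by rewrite -/(d i) d0// mul0r subr0.
  rewrite -mulrA -/(wmeanf f w x T); move: hu; lra.
have sp : 0 < s by rewrite lt_neqAle eq_sym sN0.
have hP : forall i, i \in P -> 0 <= w i * (x i - u) / s.
  by move=> i iP; rewrite divr_ge0// dP.
have hN : forall i, i \in N -> 0 <= w i * (x i - u) / - s.
  by move=> i iP; rewrite invrN mulrN -mulNr divr_ge0// dN.
have := sum_convex_function_opposite hI hf w0 Ix Iu sN0 hP erefl sN PN.
have sN0' : - s != 0 by rewrite oppr_eq0.
have := sum_convex_function_opposite hI hf w0 Ix Iu sN0' hN sN
  (esym (opprK s)) NP.
rewrite (TPN (fun i => k i * _)) (TPN (fun i => w i * f _)).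
have -> : (#|T|%:R - 2) * wmeanf f w x T
    = (\sum_(i in P) k i + \sum_(i in N) k i
        - (\sum_(i in P) w i + \sum_(i in N) w i)) * f u.
  by rewrite -!TPN sk -/(wsum w T) /wmeanf -/u; ring.
move=> h1 h2; have := lerD h1 h2; lra.
Qed.

(** * Double counting and descending induction on the cardinality *)

(** Pairs of a set [T] and a member [i] correspond to pairs of a set [S] and an [i] outside it,
    through [S = T :\ i]. *)
Lemma sum_setD1_exchange (R : realType) (X : finType) (m : nat)
    (F : {set X} -> X -> R) :
  \sum_(T : {set X} | #|T| == m.+1) \sum_(i in T) F (T :\ i) i
  = \sum_(S : {set X} | #|S| == m) \sum_(i in ~: S) F S i.
Proof.
rewrite (exchange_big_dep predT)//= [RHS](exchange_big_dep predT)//=.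
apply: eq_bigr => i _.
rewrite (reindex_onto (fun S => i |: S) (fun T => T :\ i)) /=; last first.
  by move=> T /andP[_ iT]; rewrite finset.setD1K.
apply: eq_big => [S|S /andP[_ /eqP ->]]//.
rewrite finset.in_setC finset.setU11 andbT; have [iS|iS] := boolP (i \in S).
  rewrite andbF; apply/negbTE; rewrite negb_and; apply/orP; right.
  by apply/eqP => /finset.setP/(_ i); rewrite !inE eqxx iS.
by rewrite finset.setU1K// eqxx !andbT cardsU1 iS.
Qed.

(** Each [i] lies in as many sets of cardinality [m.+1] as there are [m]-subsets avoiding [i]. *)
Lemma sum_card_sum (R : realType) (X : finType) (m : nat) (a : X -> R) :
  \sum_(T : {set X} | #|T| == m.+1) \sum_(i in T) a i
  = 'C(#|X|.-1, m)%:R * \sum_i a i.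
Proof.
rewrite (sum_setD1_exchange _ (fun=> a)) (exchange_big_dep predT)//= mulr_sumr.
apply: eq_bigr => i _; rewrite sumr_const mulr_natl; congr (_ *+ _).
rewrite -(cardsC1 i) -cards_draws cardsE; apply: eq_card => S.
by rewrite !unfold_in andbC finset.subsetC finset.sub1set.
Qed.

(** The bound for one omitted index is summed over all [T] of cardinality [m.+2]: each [S] of
    cardinality [m.+1] arises once for each of its [n.+1 - m] outside elements, and
    [#|T| - 2 = m]. *)
Lemma sum_wmeanf_step (R : realType) (I : set R) (f : R -> R)
    (X : finType) (w x : X -> R) (n m : nat) :
    is_interval I -> convex_function I f ->
    (forall i, 0 <= w i) -> (forall i, I (x i)) -> #|X| = n.+2 -> (m <= n)%N ->
    (forall S : {set X}, #|S| = m.+1 -> 0 < wsum w S) ->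
  (n.+1 - m)%:R * \sum_(S : {set X} | #|S| == m.+1) wmeanf f w x S
    <= 'C(n.+1, m.+1)%:R * \sum_i w i * f (x i)
       + m%:R * \sum_(S : {set X} | #|S| == m.+2) wmeanf f w x S.
Proof.
move=> hI hf w0 Ix cX mn hS.
have := @sum_card_sum R X m.+1 (fun i => w i * f (x i)); rewrite cX /= => <-.
rewrite [X in _ + X]mulr_sumr -big_split /=.
have -> : (n.+1 - m)%:R * \sum_(S : {set X} | #|S| == m.+1) wmeanf f w x S
    = \sum_(T : {set X} | #|T| == m.+2) \sum_(i in T) wmeanf f w x (T :\ i).
  rewrite (sum_setD1_exchange _ (fun S _ => wmeanf f w x S)) mulr_sumr.
  apply: eq_bigr => S /eqP cS; rewrite sumr_const mulr_natl; congr (_ *+ _).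
  by rewrite cardsCs finset.setCK cS cX subSS.
apply: ler_sum => T /eqP cT.
have hT i : i \in T -> 0 < wsum w (T :\ i).
  by move=> iT; apply: hS; have := cardsD1 i T; rewrite iT cT => -[].
have WT : 0 < wsum w T.
  have [i iT] : exists i, i \in T by apply/card_gt0P; rewrite cT.
  by apply: lt_le_trans (hT i iT) _; apply: wsum_subset => //; exact: finset.subsetDl.
have := sum_wmeanf_setD1_le hI hf w0 Ix WT hT; rewrite cT.
by have -> : m.+2%:R - 2 = m%:R :> R by rewrite -addn2 natrD addrK.
Qed.

(** Pascal's rule and the absorption identity; this matches the coefficients of the sum of
    [w i * f (x i)] in the induction step. *)
Lemma mul_binS_left (n m : nat) : (m <= n)%N ->
  ('C(n.+1, m.+1) + m * 'C(n, m.+1) = (n.+1 - m) * 'C(n, m))%N.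
Proof.
move=> mn; have := mul_bin_left n m; rewrite binS subSn//.
move: 'C(n, m) 'C(n, m.+1) (n - m)%N => a b c; lia.
Qed.

(** The inequality for at least two points, with both sizes shifted: [n.+2] points and subsets of
    size [m.+1]. The second coefficient is 0 for singletons, that is, for [m = 0]. *)
Lemma sum_wmeanf_le (R : realType) (I : set R) (f : R -> R)
    (X : finType) (w x : X -> R) (n m : nat) :
    is_interval I -> convex_function I f ->
    (forall i, 0 <= w i) -> (forall i, I (x i)) -> #|X| = n.+2 ->
    (forall S : {set X}, #|S| = m.+1 -> 0 < wsum w S) ->
  \sum_(S : {set X} | #|S| == m.+1) wmeanf f w x S
    <= 'C(n, m)%:R * (\sum_i w i * f (x i))
       + (if m is m'.+1 then 'C(n, m') else 0%N)%:R * wmeanf f w x [set: X].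
Proof.
move=> hI hf w0 Ix cX hS.
have [mn|nm] := leqP m n.+1; last first.
  rewrite big_pred0 => [|S].
    case: m nm {hS} => [//|m] nm; rewrite !bin_small ?mul0r ?addr0//.
    by rewrite (leq_trans _ nm).
  by apply/negbTE/eqP => cS; move: nm; rewrite -ltnS -cS ltnNge -cX max_card.
(* Descending induction through [k = n.+1 - m]. In the base case the full set is the only subset,
   and equality holds as ['C(n, n.+1) = 0] and ['C(n, n) = 1]. *)
elim: (n.+1 - m)%N {-2}m (erefl (n.+1 - m)%N) mn hS => [|k IH] {}m km mn hS.
  have -> : m = n.+1 by apply/eqP; rewrite eqn_leq mn -subn_eq0 km.
  rewrite bin_small// mul0r add0r binn mul1r.
  rewrite (big_pred1 [set: X])// => S /=; rewrite -cX.
  by rewrite eqEcard finset.subsetT cardsT /= eqn_leq max_card.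
have {}mn : (m <= n)%N by lia.
have hS' (S : {set X}) : #|S| = m.+2 -> 0 < wsum w S.
  move=> cS; have [i iS] : exists i, i \in S by apply/card_gt0P; rewrite cS.
  apply: lt_le_trans (hS (S :\ i) _) _.
    by have := cardsD1 i S; rewrite iS cS => -[].
  by apply: wsum_subset => //; exact: finset.subsetDl.
have := IH m.+1 _ _ hS'; rewrite ltnS mn => /(_ _ isT) {}IH.
have {}IH := IH ltac:(lia).
have := sum_wmeanf_step hI hf w0 Ix cX mn hS.
have np : 0 < (n.+1 - m)%:R :> R by rewrite ltr0n; lia.
move=> h; rewrite -(ler_pM2l np); apply: (le_trans h).
apply: le_trans (lerD (lexx _) (ler_wpM2l (ler0n R m) IH)) _.
rewrite !mulrDr addrA !mulrA -mulrDl -!natrM -natrD mul_binS_left// lerD2l.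
(* The coefficients of the full set remain: both are 0 at [m = 0], and otherwise they agree by
   absorption. *)
case: m {km hS hS' IH np h} mn => [|m] mn; first by rewrite mul0n muln0.
by rewrite mul_bin_left subSS.
Qed.

(** * Integer binomial coefficients and the theorem *)

Lemma binomz_nat (R : numFieldType) (n k : nat) : binomz R n%:Z k%:Z = 'C(n, k)%:R.
Proof.
rewrite /binomz; have kN0 : (k`!)%:R != 0 :> R by rewrite pnatr_eq0 -lt0n fact_gt0.
apply: (mulIf kN0); rewrite mulfVK// -natrM bin_ffact.
elim: k {kN0} => [|k IH]; first by rewrite big_ord0.
rewrite big_ord_recr /= IH ffactnSr natrM.
(* Past [k = n] the falling factorial is already 0, so the negative factor [n - k] is harmless. *)
have [kn|nk] := leqP k n; first by rewrite subzn// -pmulrn.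
by rewrite ffact_small// !mul0r.
Qed.

(** Each factor [-1 - i] is [- i.+1], so the product is the factorial of [k] up to sign. *)
Lemma binomzN1 (R : numFieldType) (k : nat) : binomz R (-1) k%:Z = (-1) ^+ k.
Proof.
rewrite /binomz; have kN0 : (k`!)%:R != 0 :> R by rewrite pnatr_eq0 -lt0n fact_gt0.
apply: (mulIf kN0); rewrite mulfVK//.
elim: k {kN0} => [|k IH]; first by rewrite big_ord0 mulr1.
rewrite big_ord_recr /= IH exprSr -!mulrA factS natrM; congr (_ * _).
have -> : -1 - k%:Z = - k.+1%:Z by lia.
by rewrite mulrNz -pmulrn mulrN mulN1r mulrC.
Qed.

Lemma sum_setT (R : nmodType) (X : finType) (F : X -> R) :
  \sum_(i in [set: X]) F i = \sum_i F i.
Proof. by apply: eq_bigl => i; rewrite finset.in_setT. Qed.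

Unset Implicit Arguments.

Theorem mainTheorem2 (R : realType) (I : set R) (f : R -> R)
    (hI : is_interval I) (hf : convex_function I f)
    (n : nat) (x w : 'I_n -> R) (m : int)
    (hx : forall i, I (x i))
    (hw : forall i, 0 <= w i)
    (hwn : \sum_(i < n) w i != 0)
    (hwm : forall S : {set 'I_n}, is_choice m S -> \sum_(i in S) w i != 0) :
  binomz R (n%:Z - 2) (m - 1) * (\sum_(i < n) w i * f (x i))
  + binomz R (n%:Z - 2) (m - 2) * (\sum_(i < n) w i)
    * f ((\sum_(i < n) w i * x i) / (\sum_(i < n) w i))
  >= \sum_(S : {set 'I_n} | is_choice m S)
       (\sum_(i in S) w i)
       * f ((\sum_(i in S) w i * x i) / (\sum_(i in S) w i)).
Proof.
(* For [m <= 0] there is no choice and both lower arguments are negative, so both sides are 0. *)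
case: m hwm => [[|m]|m] hwm; try by
  rewrite big_pred0 // /binomz !mul0r addr0.
have ich (S : {set 'I_n}) : is_choice m.+1 S = (#|S| == m.+1) by [].
rewrite (eq_bigl _ _ ich).
have -> : m.+1%:Z - 1 = m%:Z by lia.
have -> : m.+1%:Z - 2 = if m is m'.+1 then m'%:Z else -1 by case: (m) => [|k]; lia.
case: n x w hx hw hwn hwm ich => [|[|n]] x w hx hw hwn hwm ich.
- by rewrite big_ord0 eqxx in hwn.
(* A single point, which is its own mean. Equality holds for singletons; for larger sizes there is
   no choice, and the two coefficients, consecutive powers of -1, cancel. *)
- have -> : 1%:Z - 2 = -1 by [].
  rewrite binomzN1 !big_ord1; rewrite big_ord1 in hwn.
  rewrite -mulrA mulrAC divff// mul1r.
  case: m {hwm} ich => [|m] ich; last first.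
    rewrite binomzN1 big_pred0 => [|S].
      by rewrite exprS mulN1r mulNr addNr.
    by apply/negbTE/eqP => cS; have := max_card S; rewrite cS card_ord.
  rewrite (big_pred1 [set: 'I_1]) => [|S /=].
    by rewrite !sum_setT !big_ord1 mulrAC divff// !mul1r mul0r addr0.
  by rewrite eqEcard finset.subsetT cardsT card_ord eqn_leq (leq_trans (max_card _)) ?card_ord.
- have -> : n.+2%:Z - 2 = n%:Z by lia.
  have hS (S : {set 'I_n.+2}) : #|S| = m.+1 -> 0 < wsum w S.
    move=> /eqP cS; rewrite lt_neqAle eq_sym; apply/andP; split.
      by apply: hwm; rewrite ich.
    exact: sumr_ge0.
  have := sum_wmeanf_le hI hf hw hx (card_ord _) hS.
  rewrite /wmeanf /wmean /wsum !sum_setT binomz_nat mulrA.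
  by case: (m) => [|k]; rewrite ?binomz_nat.
Qed.
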